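(* Let $R$ be a Noetherian ring and let $x_1,\ldots,x_t\in R$ be a permutable regular sequence. Then there exist a finite set $\Lambda$ of prime ideals of $R$ and a constant $C\in\mathbb{N}$ such that for every $n_1,\ldots,n_t\in\mathbb{N}$ there exists a primary decomposition $$(x_1^{n_1},\ldots,x_t^{n_t})=Q_1\cap\cdots\cap Q_\ell$$ such that $\sqrt{Q_i}\in\Lambda$ and $\sqrt{Q_i}^{\,C(n_1+\cdots+n_t)}\subseteq Q_i$ for all $1\leq i\leq \ell$.
   Context: Rings are commutative with identity. A sequence $x_1,\ldots,x_t$ in $R$ is a permutable regular sequence if every permutation of it is a regular sequence on $R$. A primary decomposition of an ideal $I$ is an expression of $I$ as a finite intersection of primary ideals (not required to be irredundant); here $\ell$ and the $Q_i$ may depend on $n_1,\ldots,n_t$, whereas $\Lambda$ and $C$ do not. $\mathbb{N}=\{0,1,2,\ldots\}$; when some $n_i=0$ the ideal is $R$, which is regarded as the empty intersection ($\ell=0$). *)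

(* Defs.v *)
From HB Require Import structures.
From mathcomp Require Import all_boot all_order all_fingroup all_algebra.
From mathcomp Require Import boolp classical_sets cardinality.

Set Implicit Arguments.
Unset Strict Implicit.
Unset Printing Implicit Defensive.

Import GRing.Theory.
Local Open Scope classical_set_scope.
Local Open Scope ring_scope.

(* The ideals of ring_quotient are boolean and always proper, which excludes
   the unit ideal; here ideals are arbitrary subsets and may be the whole
   ring. *)
Definition is_ideal (R : comPzRingType) (I : set R) : Prop :=
  [/\ I 0,
      forall a b, I a -> I b -> I (a + b)
    & forall r a, I a -> I (r * a)].

Definition ideal_gen (R : comPzRingType) (A : set R) : set R :=
  smallest (@is_ideal R) A.

Definition noetherian (R : comPzRingType) : Prop :=
  forall I : set R, is_ideal I ->
    exists A : set R, finite_set A /\ I = ideal_gen A.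

Definition prime_ideal (R : comPzRingType) (P : set R) : Prop :=
  [/\ is_ideal P, ~ P 1 & forall a b, P (a * b) -> P a \/ P b].

Definition radical (R : comPzRingType) (I : set R) : set R :=
  [set a | exists k : nat, I (a ^+ k)].

Definition primary_ideal (R : comPzRingType) (Q : set R) : Prop :=
  [/\ is_ideal Q, ~ Q 1 & forall a b, Q (a * b) -> Q a \/ radical Q b].

Definition ideal_mul (R : comPzRingType) (I J : set R) : set R :=
  ideal_gen [set a * b | a in I & b in J].

(* The zeroth power is the unit ideal. *)
Definition ideal_pow (R : comPzRingType) (I : set R) (k : nat) : set R :=
  iter k (ideal_mul I) [set: R].

(* x_i is a nonzerodivisor modulo (x_j : j < i) for each i, and the ideal
   generated by the whole sequence is proper. *)
Definition regular_sequence (R : comPzRingType) (t : nat) (x : 'I_t -> R)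
    : Prop :=
  (forall (i : 'I_t) (r : R),
     ideal_gen [set x j | j in [set j : 'I_t | (j < i)%N]] (x i * r) ->
     ideal_gen [set x j | j in [set j : 'I_t | (j < i)%N]] r)
  /\ ~ ideal_gen (range x) 1.

Definition permutable_regular_sequence (R : comPzRingType) (t : nat)
    (x : 'I_t -> R) : Prop :=
  forall s : 'S_t, regular_sequence (fun i => x (s i)).

(* For l = 0 the intersection is the whole ring. *)
Definition primary_decomposition (R : comPzRingType) (I : set R) (l : nat)
    (Q : 'I_l -> set R) : Prop :=
  (forall i, primary_ideal (Q i)) /\ I = \bigcap_i Q i.

(* Main.v *)
Require Import Defs.
From HB Require Import structures.
From mathcomp Require Import all_boot all_order all_fingroup all_algebra.
From mathcomp Require Import boolp classical_sets cardinality.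
From mathcomp Require Import ring zify.

Set Implicit Arguments.
Unset Strict Implicit.
Unset Printing Implicit Defensive.

Import GRing.Theory.
Local Open Scope classical_set_scope.
Local Open Scope ring_scope.

(* Write I = (x_1, ..., x_t), J = (x_1^n_1, ..., x_t^n_t) with all n_i > 0, and
   top = x_1^(n_1 - 1) ... x_t^(n_t - 1).  Fix a primary decomposition of I with
   components q_i and radicals P_i; the components of J are the contractions of
   (P_i^e + J)_{P_i} with e = C (n_1 + ... + n_t).  To see that they intersect
   in J, take r outside J.  Regularity makes the I-adic filtration of R/J have
   free graded pieces over R/I, based on monomials, so that some monomial
   multiple of r is s * top modulo J with s outside I.  If r lies in the i-th
   component, then w s * top is congruent modulo J to an element of P_i^e for
   some w outside P_i.  Going up the degrees of the filtration, the coefficients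
   of this element in degrees below that of top must lie in I, and the
   Artin-Rees inclusion (P^k meet I) inside P^(k - h) I lets one pass to the
   next degree at the cost of h in the exponent.  There are at most
   n_1 + ... + n_t degrees, so w s lies in P_i^c + I with c still large enough
   for P_i^c to be inside q_i; hence s is in q_i.  If this holds for all i, s is
   in I, a contradiction. *)

(** * Ideals and Noetherian rings *)

Section Ideals.
Variable R : comPzRingType.
Implicit Types (I J K P : set R) (A : set R) (a b r u z : R).

Lemma ideal_gen_ideal A : is_ideal (ideal_gen A).
Proof.
split=> [|a b Aa Ab|r a Aa] M [idM AM]; case: (idM) => M0 MD MM //.
- by apply: MD; [apply: Aa|apply: Ab].
- by apply: MM; apply: Aa.
Qed.

Lemma sub_ideal_gen A : A `<=` ideal_gen A.
Proof. exact: sub_gen_smallest. Qed.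

Lemma ideal_gen_sub A I : is_ideal I -> A `<=` I -> ideal_gen A `<=` I.
Proof. exact: smallest_sub. Qed.

Lemma ideal_gen_mono A1 A2 : A1 `<=` A2 -> ideal_gen A1 `<=` ideal_gen A2.
Proof.
move=> A12; apply: ideal_gen_sub; first exact: ideal_gen_ideal.
by move=> z /A12; apply: sub_ideal_gen.
Qed.

Lemma ideal0 I : is_ideal I -> I 0.
Proof. by case. Qed.

Lemma idealD I a b : is_ideal I -> I a -> I b -> I (a + b).
Proof. by case=> _ ID _; apply: ID. Qed.

Lemma ideal_mull I r a : is_ideal I -> I a -> I (r * a).
Proof. by case=> _ _; apply. Qed.

Lemma ideal_mulr I r a : is_ideal I -> I a -> I (a * r).
Proof. by rewrite mulrC; apply: ideal_mull. Qed.

Lemma idealN I a : is_ideal I -> I a -> I (- a).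
Proof. by rewrite -mulN1r; apply: ideal_mull. Qed.

Lemma idealB I a b : is_ideal I -> I a -> I b -> I (a - b).
Proof. by move=> idI Ia Ib; apply: idealD => //; apply: idealN. Qed.

Lemma idealDr I a b : is_ideal I -> I (a + b) -> I b -> I a.
Proof. by move=> idI Iab Ib; rewrite -(addrK b a); apply: idealB. Qed.

Lemma ideal_sum I (T : Type) (s : seq T) (p : pred T) (F : T -> R) :
  is_ideal I -> (forall i, p i -> I (F i)) -> I (\sum_(i <- s | p i) F i).
Proof.
move=> idI IF; apply: (big_ind I) => //; first exact: ideal0.
by move=> a b; apply: idealD.
Qed.

Lemma setT_ideal : is_ideal [set: R].
Proof. by []. Qed.

Definition adjoin K u : set R := [set z | exists r, K (z - u * r)].

Lemma adjoin_ideal K u : is_ideal K -> is_ideal (adjoin K u).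
Proof.
move=> idK; split.
- by exists 0; rewrite mulr0 subr0; apply: ideal0.
- move=> a b [r Kr] [s Ks]; exists (r + s).
  by rewrite (_ : _ - _ = (a - u * r) + (b - u * s)); [apply: idealD|ring].
- move=> c a [r Kr]; exists (c * r).
  by rewrite (_ : _ - _ = c * (a - u * r)); [apply: ideal_mull|ring].
Qed.

Lemma sub_adjoin K u : K `<=` adjoin K u.
Proof. by move=> z Kz; exists 0; rewrite mulr0 subr0. Qed.

Lemma adjoin_mem K u : is_ideal K -> adjoin K u u.
Proof. by move=> idK; exists 1; rewrite mulr1 subrr; apply: ideal0. Qed.

Lemma adjoin_sub K u I : is_ideal I -> K `<=` I -> I u -> adjoin K u `<=` I.
Proof.
move=> idI KI Iu z [r /KI Iz].
by rewrite -(subrK (u * r) z); apply: idealD => //; apply: ideal_mulr.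
Qed.

Lemma ideal_genU1 A u : ideal_gen (u |` A) = adjoin (ideal_gen A) u.
Proof.
have idA := ideal_gen_ideal A; have idU := ideal_gen_ideal (u |` A).
apply/seteqP; split.
  apply: ideal_gen_sub; first exact: adjoin_ideal.
  move=> z [->|Az]; first exact: adjoin_mem.
  by apply: sub_adjoin; apply: sub_ideal_gen.
apply: adjoin_sub => //.
- by apply: ideal_gen_mono => z; right.
- by apply: sub_ideal_gen; left.
Qed.

Lemma ideal_gen0 : ideal_gen (@set0 R) = [set 0].
Proof.
apply/seteqP; split; last by move=> z ->; apply: ideal0; apply: ideal_gen_ideal.
apply: ideal_gen_sub => //; split=> //.
- by move=> a b /= -> ->; rewrite addr0.
- by move=> r a /= ->; rewrite mulr0.
Qed.

Lemma ideal_mul_ideal I J : is_ideal (ideal_mul I J).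
Proof. exact: ideal_gen_ideal. Qed.

Lemma ideal_mul_mem I J a b : I a -> J b -> ideal_mul I J (a * b).
Proof. by move=> Ia Jb; apply: sub_ideal_gen; exists a => //; exists b. Qed.

Lemma ideal_mul_sub I J K : is_ideal K ->
  (forall a b, I a -> J b -> K (a * b)) -> ideal_mul I J `<=` K.
Proof.
by move=> idK IJK; apply: ideal_gen_sub => // z [a Ia [b Jb <-]]; apply: IJK.
Qed.

Lemma ideal_pow_ideal I k : is_ideal (ideal_pow I k).
Proof. by case: k => [|k]; [apply: setT_ideal|apply: ideal_mul_ideal]. Qed.

Lemma ideal_powD I i j a b : ideal_pow I i a -> ideal_pow I j b ->
  ideal_pow I (i + j) (a * b).
Proof.
move=> + Ib; elim: i a => [|i IHi] a.
  by move=> _; apply: ideal_mull => //; apply: ideal_pow_ideal.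
have idI := ideal_pow_ideal I (i + j).+1.
(* The elements whose product with [b] lies in the power form an ideal, so it suffices to treat the
   generating products [u * v]. *)
rewrite addSn => Ia; suff : [set a | ideal_pow I (i + j).+1 (a * b)] a by [].
apply: (ideal_mul_sub _ _ Ia) => /=.
  split=> /= [|a1 a2|r a1]; rewrite ?mul0r ?mulrDl -?mulrA.
  - exact: ideal0.
  - exact: idealD.
  - exact: ideal_mull.
move=> u v Iu Iv; rewrite -mulrA; apply: ideal_mul_mem => //; exact: IHi.
Qed.

Lemma ideal_powX I k a : I a -> ideal_pow I k (a ^+ k).
Proof.
by move=> Ia; elim: k => // k IHk; rewrite exprS; apply: ideal_mul_mem.
Qed.

Lemma ideal_pow_le I i j : (i <= j)%N -> ideal_pow I j `<=` ideal_pow I i.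
Proof.
move=> /subnK <-; elim: (j - i)%N => // k IHk.
rewrite addSn; apply: ideal_mul_sub; first exact: ideal_pow_ideal.
by move=> a b _ Ib; apply: ideal_mull; [apply: ideal_pow_ideal|apply: IHk].
Qed.

Lemma ideal_pow_sub I k : is_ideal I -> (0 < k)%N -> ideal_pow I k `<=` I.
Proof.
move=> idI k0 z /(ideal_pow_le k0); apply: ideal_mul_sub => // a b Ia _.
exact: ideal_mulr.
Qed.

Lemma ideal_pow_mono I J k : I `<=` J -> ideal_pow I k `<=` ideal_pow J k.
Proof.
move=> IJ; elim: k => // k IHk; apply: ideal_mul_sub.
  exact: ideal_mul_ideal.
by move=> a b /IJ Ja /IHk; apply: ideal_mul_mem.
Qed.

End Ideals.

(** * Chain conditions and the existence of primary decompositions *)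

Section Noetherian.
Variable R : comPzRingType.
Hypothesis R_noeth : noetherian R.
Implicit Types (I J K P Q : set R) (a b r u z : R).

Lemma noetherian_seq I : is_ideal I ->
  exists s : seq R, I = ideal_gen [set` s].
Proof. by move=> /R_noeth[A [/finite_seqP[s ->] ->]]; exists s. Qed.

Lemma ascending_le (f : nat -> set R) : (forall n, f n `<=` f n.+1) ->
  forall i j, (i <= j)%N -> f i `<=` f j.
Proof.
by move=> f_asc i j /subnK <-; elim: (j - i)%N => // k IHk z /IHk /f_asc.
Qed.

(** The union of the chain is an ideal, and its finitely many generators already lie in one term. *)
Lemma ascending_chain (f : nat -> set R) :
  (forall n, is_ideal (f n)) -> (forall n, f n `<=` f n.+1) ->
  exists n, forall m, f m `<=` f n.
Proof.
move=> idf f_asc; have f_le := ascending_le f_asc.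
have [|s Us] := @noetherian_seq (\bigcup_n f n).
  split.
  - by exists 0%N => //; apply: ideal0.
  - move=> a b [i _ fa] [j _ fb]; exists (maxn i j) => //.
    by apply: idealD => //; [apply: f_le fa|apply: f_le fb]; lia.
  - by move=> r a [i _ fa]; exists i => //; apply: ideal_mull.
have [n sn] : exists n, [set` s] `<=` f n.
  have : [set` s] `<=` \bigcup_n f n by rewrite Us; apply: sub_ideal_gen.
  elim: s {Us} => [|c s IHs] sU; first by exists 0%N.
  have [|n sn] := IHs; first by move=> z zs; apply: sU; rewrite /= inE zs orbT.
  have [|m _ fc] := sU c; first by rewrite /= mem_head.
  exists (maxn m n) => z; rewrite /= inE => /orP[/eqP->|/sn].
    by apply: f_le fc; lia.
  by apply: f_le; lia.
exists n => m z fz; have : (\bigcup_n f n) z by exists m.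
by rewrite Us; apply: ideal_gen_sub.
Qed.

Lemma noetherian_maximal (F : set (set R)) I :
  F `<=` @is_ideal R -> F I ->
  exists2 M, F M & forall J, F J -> M `<=` J -> J `<=` M.
Proof.
move=> Fid FI; apply: contrapT => nmax.
have /boolp.choice[g gP] : forall J, exists K,
    F J -> [/\ F K, J `<=` K & ~ (K `<=` J)].
  move=> J; have [FJ|] := pselect (F J); last by exists J.
  apply: contrapT => nK; apply: nmax; exists J => // K FK JK.
  by apply: contrapT => nKJ; apply: nK; exists K.
pose f n := iter n g I.
have Ff n : F (f n) by elim: n => // n /gP[].
have [|n|n] := @ascending_chain f; first by move=> n; apply/Fid/Ff.
  by have [] := gP _ (Ff n).
move=> /(_ n.+1); by have [] := gP _ (Ff n).
Qed.

Definition decomposable I :=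
  exists (l : nat) (Q : 'I_l -> set R), primary_decomposition I Q.

Lemma decomposableI J K :
  decomposable J -> decomposable K -> decomposable (J `&` K).
Proof.
move=> [l1 [Q1 [prQ1 ->]]] [l2 [Q2 [prQ2 ->]]].
exists (l1 + l2)%N.
exists (fun i => match split i with inl j => Q1 j | inr j => Q2 j end).
split; first by move=> i; case: (split i).
apply/seteqP; split.
  by move=> z [Q1z Q2z] i _; case: (split i) => j; [apply: Q1z|apply: Q2z].
move=> z Qz; split=> j _.
- by have := Qz (unsplit (inl j)) I; rewrite unsplitK.
- by have := Qz (unsplit (inr j)) I; rewrite unsplitK.
Qed.

(** Noetherian induction: a maximal counterexample [J] is proper and not primary, which makes it an
    intersection of two strictly larger, hence decomposable, ideals. *)
Lemma lasker_noether I : is_ideal I -> decomposable I.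
Proof.
move=> idI; apply: contrapT => ndecI.
have [J [idJ ndecJ] maxJ] := @noetherian_maximal
  (fun J => is_ideal J /\ ~ decomposable J) I (fun J => @proj1 _ _)
  (conj idI ndecI).
have dec_gt K : is_ideal K -> J `<=` K -> ~ (K `<=` J) -> decomposable K.
  by move=> idK JK nKJ; apply: contrapT => ndecK; apply/nKJ/maxJ.
apply: ndecJ; have [J1|nJ1] := pselect (J 1).
  exists 0%N, (fun=> setT); split; first by case.
  apply/seteqP; split=> z // _; rewrite -(mulr1 z); exact: ideal_mull.
have [prJ|] := pselect (primary_ideal J).
  exists 1%N, (fun=> J); split=> //.
  by apply/seteqP; split=> z; [move=> Jz i _|move=> /(_ ord0 Logic.I)].
move=> nprJ; have [a [b [Jab nJa nJb]]] :
    exists a b, [/\ J (a * b), ~ J a & ~ radical J b].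
  apply: contrapT => nab; apply: nprJ; split=> // a b Jab.
  apply: contrapT => /not_orP[nJa nJb]; apply: nab; by exists a, b.
(* The colon ideals (J : b^m) increase with m, so one of them, at [n], contains all the others; this
   yields J = (J + (a)) meet (J + (b^n)). *)
have [n Jn] : exists n, forall m,
    [set r | J (r * b ^+ m)] `<=` [set r | J (r * b ^+ n)].
  apply: ascending_chain => [n|n r /= Jr].
    split=> /= [|r s|c r]; rewrite ?mul0r ?mulrDl -?mulrA.
    - exact: ideal0.
    - exact: idealD.
    - exact: ideal_mull.
  by rewrite exprSr mulrA; apply: ideal_mulr.
have -> : J = adjoin J a `&` adjoin J (b ^+ n).
  apply/seteqP; split=> z; first by move=> Jz; split; apply: sub_adjoin.
  move=> [[r Jr] [s Js]].
  have Jzb : J (z * b).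
    rewrite (_ : z * b = (z - a * r) * b + r * (a * b)); last by ring.
    by apply: idealD => //; [apply: ideal_mulr|apply: ideal_mull].
  (* Since z = b^n s modulo J, b^(n+1) s is in J; by the choice of [n] so is b^n s, and therefore
     z. *)
  have /Jn /= Jsb : J (s * b ^+ n.+1).
    rewrite (_ : _ * _ = z * b - (z - b ^+ n * s) * b).
      by apply: idealB => //; apply: ideal_mulr.
    by rewrite exprSr; ring.
  by rewrite -(subrK (b ^+ n * s) z); apply: idealD => //; rewrite mulrC.
apply: decomposableI; apply: dec_gt; try exact: adjoin_ideal;
  try exact: sub_adjoin.
- by move=> /(_ a (adjoin_mem _ idJ)).
- by move=> /(_ _ (adjoin_mem _ idJ)) Jb; apply: nJb; exists n.
Qed.

End Noetherian.

(** * The Artin-Rees lemma *)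

Section GradedNoetherian.
Variable R : comPzRingType.
Implicit Types (I J K P Q : set R) (A N : nat -> set R) (a b r u z : R).

(** For [A] the powers of an ideal, [N] lists the homogeneous pieces of a graded submodule of R[T]
    over the Rees algebra; keeping them as ideals of [R] avoids the variable T. *)
Definition graded_ideal A N : Prop :=
  (forall e, is_ideal (N e)) /\
  forall i e u v, A i u -> N e v -> N (i + e)%N (u * v).

(* Finite generation of the graded ideals N of A by elements of bounded degree,
   with "generated in degrees at most h" phrased through the graded ideals N'
   that contain the pieces of N up to degree h. *)
Definition graded_noetherian A : Prop :=
  forall N, graded_ideal A N -> (forall e, N e `<=` A e) ->
  exists h : nat, forall N', graded_ideal A N' ->
    (forall j, (j <= h)%N -> N j `<=` N' j) -> forall e, N e `<=` N' e.

Lemma graded_noetherian0 : graded_noetherian (ideal_pow [set 0 : R]).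
Proof.
move=> N [idN NA] NP; exists 0%N => N' [idN' _] NN' [|e] z; first exact: NN'.
move=> /NP Pz; suff -> : z = 0 by apply: ideal0.
apply: (ideal_mul_sub (K := [set 0]) _ _ Pz); last first.
  by move=> a b -> _; rewrite /= mul0r.
split=> //= [a b -> ->|r a ->]; by rewrite ?addr0 ?mulr0.
Qed.

(** * Powers of P + (y) as polynomials in y *)

Section Adjoin.
Variables (P : set R) (y : R).
Hypothesis idP : is_ideal P.
Let A := ideal_pow P.

(* The degree e piece of the polynomials of degree < d in y over the Rees
   algebra of P; e - i is meaningful only for d <= e + 1. *)
Definition poly_lt (d e : nat) : set R :=
  [set b | exists c : nat -> R, (forall i, (i < d)%N -> A (e - i) (c i))
           /\ b = \sum_(i < d) c i * y ^+ i].

Lemma poly_lt_ideal d e : is_ideal (poly_lt d e).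
Proof.
have idA k : is_ideal (A k) by apply: ideal_pow_ideal.
split.
- exists (fun=> 0); split=> [i _|]; first exact: ideal0.
  by rewrite big1 // => i _; rewrite mul0r.
- move=> _ _ [c [Ac ->]] [c' [Ac' ->]]; exists (fun i => c i + c' i); split.
    by move=> i id; apply: idealD => //; [apply: Ac|apply: Ac'].
  by rewrite -big_split; apply: eq_bigr => i _; rewrite mulrDl.
- move=> r _ [c [Ac ->]]; exists (fun i => r * c i); split.
    by move=> i id; apply: ideal_mull => //; apply: Ac.
  by rewrite mulr_sumr; apply: eq_bigr => i _; rewrite mulrA.
Qed.

Lemma poly_ltS d e z : poly_lt d.+1 e z ->
  exists a b, [/\ A (e - d) a, poly_lt d e b & z = a * y ^+ d + b].
Proof.
move=> [c [Ac ->]]; exists (c d), (\sum_(i < d) c i * y ^+ i).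
split; first exact: Ac.
- by exists c; split=> // i id; apply: Ac; lia.
- by rewrite big_ord_recr addrC.
Qed.

Lemma poly_ltM d i e u b : (d <= e.+1)%N -> A i u -> poly_lt d e b ->
  poly_lt d (i + e) (u * b).
Proof.
move=> de Au [c [Ac ->]]; exists (fun k => u * c k); split.
  (* From [d <= e.+1] one gets k <= e, so truncated subtraction satisfies i + (e - k) = (i + e) -
     k. *)
  move=> k kd; rewrite -addnBA; last by lia.
  by apply: ideal_powD => //; apply: Ac.
by rewrite mulr_sumr; apply: eq_bigr => k _; rewrite mulrA.
Qed.

Lemma poly_ltMy d e b : poly_lt d e b -> poly_lt d.+1 e.+1 (y * b).
Proof.
move=> [c [Ac ->]]; exists (fun k => if k is k'.+1 then c k' else 0); split.
  by case=> [_|k kd]; [apply: ideal0; apply: ideal_pow_ideal|apply: Ac].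
rewrite big_ord_recl mul0r add0r mulr_sumr; apply: eq_bigr => k _ /=.
by rewrite /bump /= exprS; ring.
Qed.

Lemma poly_lt_le d d' e : (d <= d')%N -> poly_lt d e `<=` poly_lt d' e.
Proof.
move=> /subnK <- b; elim: (d' - d)%N => // k IHk /IHk[c [Ac ->]] {IHk}.
exists (fun i => if (i < k + d)%N then c i else 0); split=> [i _|].
  by case: ifP => [/Ac//|_]; apply: ideal0; apply: ideal_pow_ideal.
rewrite addSn big_ord_recr /= ltnn mul0r addr0.
by apply: eq_bigr => i _; rewrite ltn_ord.
Qed.

(** By induction on [e]: in a factor p + y r of P + (y), the term p raises the power of P in each
    coefficient, and y shifts the coefficients by one. *)
Lemma adjoin_powE e : ideal_pow (adjoin P y) e = poly_lt e.+1 e.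
Proof.
apply/seteqP; split; last first.
  move=> _ [c [Ac ->]]; have id1 := ideal_pow_ideal (adjoin P y) e.
  apply: ideal_sum => // i _; have {}Ac : A (e - i) (c i) by apply: Ac.
  have ie : (i <= e)%N by rewrite -ltnS.
  rewrite -[X in ideal_pow _ X](subnK ie); apply: ideal_powD.
    exact: ideal_pow_mono (@sub_adjoin _ P y) _ Ac.
  by apply: ideal_powX; apply: adjoin_mem.
elim: e => [z _|e IHe].
  by exists (fun=> z); split=> //; rewrite big_ord_recl big_ord0 mulr1 addr0.
have id2 := poly_lt_ideal e.+2 e.+1.
apply: ideal_mul_sub => // a b [r Pa] /IHe Fb.
rewrite (_ : a * b = (a - y * r) * b + r * (y * b)); last by ring.
apply: idealD => //; last by apply: ideal_mull => //; apply: poly_ltMy.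
apply: (@poly_lt_le e.+1) => //; rewrite -[e.+1]add1n; apply: poly_ltM => //.
by rewrite -(mulr1 (a - _)); apply: ideal_mul_mem.
Qed.

Lemma graded_noetherian_adjoin (R_noeth : noetherian R) :
  graded_noetherian A -> graded_noetherian (ideal_pow (adjoin P y)).
Proof.
move=> A_noeth N [idN NM] NB.
have idA k : is_ideal (A k) by apply: ideal_pow_ideal.
(* As in Hilbert's basis theorem: L N d is the graded ideal of coefficients of
   y^d in the elements of N that have no higher power of y. *)
pose L (N : nat -> set R) (d j : nat) : set R :=
  [set a | A j a /\
     exists2 b, poly_lt d (j + d) b & N (j + d)%N (a * y ^+ d + b)].
have AB : forall i u, A i u -> ideal_pow (adjoin P y) i u.
  by move=> i u; apply: ideal_pow_mono; apply: sub_adjoin.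
have By : ideal_pow (adjoin P y) 1 y.
  by rewrite -[X in _ X]expr1; apply: ideal_powX; apply: adjoin_mem.
have L_graded N0 d : graded_ideal (ideal_pow (adjoin P y)) N0 ->
    graded_ideal A (L N0 d).
  move=> [idN0 N0M]; split=> [e|i e u a Au [Aa [b Fb Nb]]].
    have idF := poly_lt_ideal d (e + d).
    split.
    - split; first exact: ideal0.
      exists 0; first exact: ideal0.
      by rewrite mul0r addr0; apply: ideal0.
    - move=> a1 a2 [Aa1 [b1 Fb1 Nb1]] [Aa2 [b2 Fb2 Nb2]].
      split; first exact: idealD.
      exists (b1 + b2); first exact: idealD.
      by rewrite mulrDl addrACA; apply: idealD.
    - move=> r a [Aa [b Fb Nb]]; split; first exact: ideal_mull.
      exists (r * b); first exact: ideal_mull.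
      by rewrite -mulrA -mulrDr; apply: ideal_mull.
  split; first exact: ideal_powD.
  exists (u * b); rewrite -addnA; first by apply: poly_ltM => //; lia.
  by rewrite -mulrA -mulrDr; apply: N0M => //; apply: AB.
have L_asc N0 d j : graded_ideal (ideal_pow (adjoin P y)) N0 ->
    L N0 d j `<=` L N0 d.+1 j.
  move=> [idN0 N0M] a [Aa [b Fb Nb]]; split=> //.
  exists (y * b); rewrite addnS; first exact: poly_ltMy.
  rewrite exprS mulrCA -mulrDr -add1n; exact: N0M.
have NLd d := L_graded N d (conj idN NM).
(* The union of the increasing families [L N d] is generated in degrees at most some [h]. In these
   finitely many degrees it is reached at one [d0], hence [L N d0] contains every [L N d] in all
   degrees. *)
pose Linf (j : nat) : set R := \bigcup_d L N d j.
have L_le d d' j : (d <= d')%N -> L N d j `<=` L N d' j.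
  by apply: (@ascending_le R (fun d => L N d j)) => k; apply: L_asc.
have [|j|h hP] := A_noeth Linf.
- split=> [j|i e u v Au [d _ Lv]]; last first.
    by exists d => //; apply: (NLd d).2.
  split.
  + by exists 0%N => //; apply: ideal0; apply: (NLd 0%N).1.
  + move=> a1 a2 [d1 _ La1] [d2 _ La2]; exists (maxn d1 d2) => //.
    apply: idealD; first exact: (NLd _).1.
      by apply: L_le La1; lia.
    by apply: L_le La2; lia.
  + move=> r a [d _ La]; exists d => //.
    by apply: ideal_mull => //; apply: (NLd d).1.
- by move=> a [d _ []].
have [d0 d0P] :
    exists d0, forall j, (j <= h)%N -> forall d, L N d j `<=` L N d0 j.
  elim: h {hP} => [|h [d0 IH]].
    have [||d0 d0P] := ascending_chain R_noeth (f := fun d => L N d 0%N).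
    - by move=> d; apply: (NLd d).1.
    - by move=> d; apply: L_asc.
    by exists d0 => j; rewrite leqn0 => /eqP ->.
  have [||d1 d1P] := ascending_chain R_noeth (f := fun d => L N d h.+1).
  - by move=> d; apply: (NLd d).1.
  - by move=> d; apply: L_asc.
  exists (maxn d0 d1) => j; rewrite leq_eqVlt => /orP[/eqP->|jh] d a La.
    by apply: (@L_le d1); [lia|apply: d1P La].
  by apply: (@L_le d0); [lia|apply: IH La].
have L_stable d j : L N d j `<=` L N d0 j.
  move=> a La; apply: (hP (L N d0) (NLd d0)); last by exists d.
  by move=> k kh b [d' _]; apply: d0P.
have /boolp.choice[hd hdP] :=
  fun d => A_noeth (L N d) (NLd d) (fun j a => @proj1 _ _).
(* A coefficient of y^d of degree i comes from an element of [N] of degree i + d, so the bound must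
   dominate [hd d + d] for every d <= d0. *)
exists (\sum_(d < d0.+1) (hd d + d))%N => N' gN' NN'.
(* Leading coefficients are to be supplied by elements of [N'] that can be subtracted without
   leaving [N]. *)
pose M e := N e `&` N' e.
have gM : graded_ideal (ideal_pow (adjoin P y)) M.
  case: gN' => idN' N'M; split=> [e|i e u v Bu [Nv N'v]]; last first.
    by split; [apply: NM|apply: N'M].
  split; first by split; apply: ideal0.
  - by move=> a b [? ?] [? ?]; split; apply: idealD.
  - by move=> r a [? ?]; split; apply: ideal_mull.
have NLM d j : L N d j `<=` L M d j.
  have small k : (k <= d0)%N -> L N k j `<=` L M k j.
    move=> kd0; apply: hdP; first exact: L_graded.
    move=> i ik a [Aa [b Fb Nb]]; split=> //; exists b => //; split=> //.
    apply: NN' Nb.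
    rewrite (bigD1 (Ordinal (kd0 : (k < d0.+1)%N))) //=; lia.
  have [/small//|/ltnW d0d a /L_stable/(small _ (leqnn d0))] := leqP d d0.
  by apply: (@ascending_le R (fun d => L M d j)) => // k; apply: L_asc.
(* Subtracting an element of [M] with the same leading coefficient lowers the degree in y. *)
have NM_poly e d z : (d <= e.+1)%N -> poly_lt d e z -> N e z -> N' e z.
  elim: d z => [|d IHd] z de.
    by move=> [c [_ ->]] _; rewrite big_ord0; apply: ideal0; apply: gN'.1.
  move=> /poly_ltS[a [b [Aa Fb ->]]] Nz.
  have : L M d (e - d)%N a.
    by apply: NLM; split=> //; rewrite subnK; [exists b|lia].
  move=> [_ [b']]; rewrite subnK; last by lia.
  move=> Fb' [Nb' N'b'].
  rewrite (_ : a * y ^+ d + b = (a * y ^+ d + b') + (b - b')); last by ring.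
  apply: idealD => //; first exact: gN'.1.
  apply: IHd; first by lia.
    by apply: idealB => //; apply: poly_lt_ideal.
  rewrite (_ : b - b' = (a * y ^+ d + b) - (a * y ^+ d + b')); last by ring.
  exact: idealB.
move=> e z Nz; apply: (NM_poly e e.+1) => //.
by rewrite -adjoin_powE; apply: NB.
Qed.

End Adjoin.

Lemma ideal_gen_cons a (s : seq R) :
  ideal_gen [set` a :: s] = adjoin (ideal_gen [set` s]) a.
Proof.
rewrite -ideal_genU1; congr ideal_gen; apply/seteqP; split=> z /=; rewrite inE.
  by move=> /orP[/eqP ->|zs]; [left|right].
by move=> [->|->]; rewrite ?eqxx ?orbT.
Qed.

Lemma ideal_gen_nil : ideal_gen [set` [::] : seq R] = [set 0].
Proof. by rewrite -ideal_gen0; congr ideal_gen; apply/seteqP; split. Qed.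

Lemma ideal_pow_noetherian P : noetherian R -> is_ideal P ->
  graded_noetherian (ideal_pow P).
Proof.
move=> R_noeth /(noetherian_seq R_noeth)[s ->].
elim: s => [|a s IHs].
  by rewrite ideal_gen_nil; apply: graded_noetherian0.
rewrite ideal_gen_cons; apply: graded_noetherian_adjoin => //.
exact: ideal_gen_ideal.
Qed.

(** The pieces P^e meet I form a graded ideal, generated in degrees at most some [h]. The ideals
    P^(e-h) I are equal to I in these degrees by truncated subtraction, so they contain the pieces
    there and hence everywhere. *)
Lemma artin_rees P I : noetherian R -> is_ideal P -> is_ideal I ->
  exists h, forall e,
    ideal_pow P e `&` I `<=` ideal_mul (ideal_pow P (e - h)) I.
Proof.
move=> R_noeth idP idI.
have [||h hP] :=
  @ideal_pow_noetherian P R_noeth idP (fun e => ideal_pow P e `&` I).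
- split=> [e|i e u v Pu [Pv Iv]]; last first.
    by split; [apply: ideal_powD|apply: ideal_mull].
  have idPe := ideal_pow_ideal P e; split; first by split; apply: ideal0.
  + by move=> a b [? ?] [? ?]; split; apply: idealD.
  + by move=> r a [? ?]; split; apply: ideal_mull.
- by move=> e z [].
exists h; apply: hP.
- split=> [e|i e u v Pu]; first exact: ideal_mul_ideal.
  move=> Pv; have idK := ideal_mul_ideal (ideal_pow P (i + e - h)) I.
  suff : [set v | ideal_mul (ideal_pow P (i + e - h)) I (u * v)] v by [].
  apply: (ideal_mul_sub _ _ Pv) => /=.
    split=> /= [|a b|r a]; rewrite ?mulr0 ?mulrDr 1?mulrCA.
    + exact: ideal0.
    + exact: idealD.
    + exact: ideal_mull.
  move=> a b Pa Ib; rewrite mulrA; apply: ideal_mul_mem => //.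
  by apply: ideal_pow_le (ideal_powD Pu Pa); lia.
- move=> j jh z [_ Iz]; rewrite -(mul1r z); apply: ideal_mul_mem => //.
  by have /eqP -> : (j - h == 0)%N by rewrite subn_eq0.
Qed.

End GradedNoetherian.

(** * Powers of a permutable regular sequence *)

Section RegularSequences.
Variables (R : comPzRingType) (t : nat) (x : 'I_t -> R).
Implicit Types (I J K : set R) (S : set 'I_t) (m b : 'I_t -> nat).
Implicit Types (r s z : R).

Definition powers_ideal S m : set R := ideal_gen [set x j ^+ m j | j in S].

Lemma powers_ideal_is_ideal S m : is_ideal (powers_ideal S m).
Proof. exact: ideal_gen_ideal. Qed.

Lemma eq_powers_ideal S m m' : (forall j, S j -> m j = m' j) ->
  powers_ideal S m = powers_ideal S m'.
Proof. by move=> mm'; congr ideal_gen; apply: eq_imagel => j /mm' ->. Qed.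

Lemma powers_ideal_adjoin S m i : S i ->
  powers_ideal S m = adjoin (powers_ideal (S `\ i) m) (x i ^+ m i).
Proof.
move=> Si; rewrite -ideal_genU1; congr ideal_gen.
by rewrite -(image_set1 (fun j => x j ^+ m j)) -image_setU setDUK // => _ ->.
Qed.

(** Induction on [n]: if z r is in K + (u^(n+1)), then r = u r' modulo K; cancelling u puts z r',
    and so r', in K + (u^n). *)
Lemma regular_adjoin_exp K u z n : is_ideal K ->
  (forall r, K (u * r) -> K r) ->
  (forall r, adjoin K u (z * r) -> adjoin K u r) ->
  forall r, adjoin K (u ^+ n) (z * r) -> adjoin K (u ^+ n) r.
Proof.
move=> idK u_reg z_reg; elim: n => [|n IHn] r.
  by move=> _; exists r; rewrite mul1r subrr; apply: ideal0.
have idKu := adjoin_ideal u idK; move=> [w Kw].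
have [r' Kr'] : adjoin K u r.
  apply: z_reg; exists (u ^+ n * w); by rewrite mulrA -exprS.
have [v Kv] : adjoin K (u ^+ n) r'.
  apply: IHn; exists w; apply: u_reg.
  rewrite (_ : u * _ = (z * r - u ^+ n.+1 * w) - z * (r - u * r')).
    by apply: idealB => //; apply: ideal_mull.
  by rewrite exprS; ring.
exists v; rewrite (_ : _ - _ = (r - u * r') + u * (r' - u ^+ n * v)).
  by apply: idealD => //; apply: ideal_mull.
by rewrite exprS; ring.
Qed.

(** Listing [A] first and [i] next turns regularity of the permuted sequence at position [k] into
    regularity of x_i modulo the variables of [A]. *)
Lemma exists_perm_prefix (A : {set 'I_t}) (i : 'I_t) : i \notin A ->
  exists (s : 'S_t) (k : 'I_t),
    s k = i /\ forall j : 'I_t, (j < k)%N = (s j \in A).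
Proof.
move=> iA; pose l := enum A ++ i :: enum (~: (i |: A)).
have l_uniq : uniq l.
  rewrite cat_uniq /= !mem_enum !enum_uniq !inE eqxx /= (negbTE iA) /= andbT.
  by apply/hasPn => j; rewrite /= !mem_enum !inE => /norP[].
have l_all j : j \in l.
  by rewrite mem_cat inE !mem_enum !inE; case: eqP; case: (j \in A).
have l_size : size l = t.
  rewrite -(card_uniqP l_uniq) -[RHS]card_ord; apply: eq_card => j.
  by rewrite l_all.
have nth_inj : injective (fun j : 'I_t => nth i l j).
  move=> j k /eqP; rewrite nth_uniq ?l_size // => /eqP jk; exact: val_inj.
have kt : (size (enum A) < t)%N 
  by apply: leq_trans (eq_leq l_size); rewrite size_cat /=; lia.
exists (perm nth_inj), (Ordinal kt); split.
  by rewrite permE /= nth_cat ltnn subnn.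
move=> j; rewrite permE /= nth_cat; case: ltnP => jA.
  by rewrite -mem_enum mem_nth.
rewrite -mem_enum; apply/esym/negbTE.
have := l_uniq; rewrite cat_uniq => /and3P[_ /hasPn lA _].
apply: lA; apply: mem_nth; have : (j < size l)%N by rewrite l_size.
by rewrite size_cat /=; lia.
Qed.

Hypothesis x_reg : permutable_regular_sequence x.

Lemma regular_mod_vars S i : ~ S i ->
  forall r, powers_ideal S (fun=> 1%N) (x i * r) ->
    powers_ideal S (fun=> 1%N) r.
Proof.
move=> nSi.
have [|s [k [ski sP]]] := @exists_perm_prefix [set j | `[< S j >]] i.
  by rewrite inE; apply/asboolPn.
have -> : powers_ideal S (fun=> 1%N) =
    ideal_gen [set x (s j) | j in [set j : 'I_t | (j < k)%N]].
  congr ideal_gen; apply/seteqP; split=> _ [j Sj <-].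
    exists (s^-1%g j); last by rewrite permKV.
    by rewrite /= sP permKV inE; apply/asboolP.
  by exists (s j) => //; move: Sj; rewrite /= sP inE => /asboolP.
by rewrite -ski; apply: (x_reg s).1.
Qed.

(** Exponents are changed from 1 one index at a time by [regular_adjoin_exp], by induction on a list
    [T] containing the indices of [S] whose exponent is not 1. *)
Lemma regular_mod_powers S m i : ~ S i ->
  forall r, powers_ideal S m (x i * r) -> powers_ideal S m r.
Proof.
have [T] : exists T : seq 'I_t, forall j, S j -> m j != 1%N -> j \in T.
  by exists (enum 'I_t) => j; rewrite mem_enum.
elim: T S m i => [|j T IHT] S m i mT nSi.
  rewrite (@eq_powers_ideal _ _ (fun=> 1%N)); first exact: regular_mod_vars.
  by move=> j /mT; case: eqP => // _ /(_ isT).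
have [Sj|nSj] := pselect (S j); last first.
  apply: IHT => // k Sk /(mT k Sk); rewrite inE => /orP[/eqP kj|//].
  by case: nSj; rewrite -kj.
have notj k : (S `\ j) k -> m k != 1%N -> k \in T.
  by move=> [Sk /eqP kj] /(mT k Sk); rewrite inE (negbTE kj).
rewrite (powers_ideal_adjoin _ Sj); apply: regular_adjoin_exp.
- exact: powers_ideal_is_ideal.
- apply: IHT; [exact: notj|by move=> [_]; apply].
(* With the exponent of [j] reset to 1, the shorter list suffices, so induction applies modulo x_j
   itself. *)
- pose m1 k := if k == j then 1%N else m k.
  have -> : adjoin (powers_ideal (S `\ j) m) (x j) = powers_ideal S m1.
    rewrite (powers_ideal_adjoin _ Sj) /m1 eqxx expr1; congr adjoin.
    by apply: eq_powers_ideal => k [_ /eqP /negbTE ->].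
  apply: IHT => // k Sk; rewrite /m1; case: (k =P j) => // kj.
  by apply: notj; split.
Qed.

Definition pow_ideal m : set R := ideal_gen (range (fun i => x i ^+ m i)).

Definition mon b : R := \prod_i x i ^+ b i.

Lemma pow_ideal_is_ideal m : is_ideal (pow_ideal m).
Proof. exact: ideal_gen_ideal. Qed.

Lemma monD b b' : mon (fun i => b i + b' i)%N = mon b * mon b'.
Proof. by rewrite -big_split; apply: eq_bigr => i _; rewrite exprD. Qed.

Lemma eq_mon b b' : b =1 b' -> mon b = mon b'.
Proof. by move=> bb'; apply: eq_bigr => i _; rewrite bb'. Qed.

Lemma mon1 i : mon (fun j => (j == i) : nat) = x i.
Proof.
rewrite /mon (bigD1 i) //= eqxx expr1 big1 ?mulr1 // => j /negbTE ->.
by rewrite expr0.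
Qed.

Lemma pow_ideal_mon m b i : (m i <= b i)%N -> pow_ideal m (mon b).
Proof.
move=> mb; have idm := pow_ideal_is_ideal m.
rewrite /mon (bigD1 i) //=; apply: (ideal_mulr _ idm).
rewrite -(subnK mb) exprD; apply: (ideal_mull _ idm).
by apply: sub_ideal_gen; exists i.
Qed.

Lemma pow_ideal_le m m' : (forall i, (m i <= m' i)%N) ->
  pow_ideal m' `<=` pow_ideal m.
Proof.
move=> mm'; apply: ideal_gen_sub; first exact: pow_ideal_is_ideal.
move=> _ [i _ <-]; rewrite -(subnK (mm' i)) exprD.
apply: (ideal_mull _ (pow_ideal_is_ideal m)).
by apply: sub_ideal_gen; exists i.
Qed.

(** The element x_i s - x_i^(m_i + 1) w factors as x_i (s - x_i^(m_i) w), and x_i cancels modulo the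
    powers of the other variables. *)
Lemma pow_ideal_cancel1 m i s :
  pow_ideal (fun j => m j + (j == i))%N (x i * s) -> pow_ideal m s.
Proof.
rewrite /pow_ideal -!/(powers_ideal setT _) !(@powers_ideal_adjoin setT _ i) //.
rewrite eqxx addn1; set K := powers_ideal _ _.
have -> : K = powers_ideal ([set: 'I_t] `\ i) m.
  by apply: eq_powers_ideal => j [_ /eqP /negbTE ->]; rewrite addn0.
move=> [w Kw]; exists w.
apply: (@regular_mod_powers _ _ i); first by case=> _ [].
by rewrite (_ : x i * _ = x i * s - x i ^+ (m i).+1 * w) // exprS; ring.
Qed.

(** Induction on the total degree of [b], cancelling one variable at a time. *)
Lemma pow_ideal_cancel m b s :
  pow_ideal (fun j => m j + b j)%N (mon b * s) -> pow_ideal m s.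
Proof.
have [k] := ubnP (\sum_i b i); elim: k b s => // k IHk b s bk.
have [b0|/existsP[i bi]] := boolP [forall i, b i == 0%N].
  rewrite (_ : mon b = 1) ?mul1r.
    by apply: pow_ideal_le => j; rewrite leq_addr.
  by rewrite /mon big1 // => i _; rewrite (eqP (forallP b0 i)).
pose b' j := (b j - (j == i))%N.
have bE j : b j = (b' j + (j == i))%N.
  by rewrite /b'; case: eqP => [->|_]; lia.
rewrite (@eq_mon b (fun j => b' j + (j == i))%N) // monD mon1.
move=> H; apply: (IHk b').
  have : (\sum_j b j = \sum_j b' j + 1)%N.
    rewrite (eq_bigr _ (fun j _ => bE j)) big_split /=; congr addn.
    by rewrite (bigD1 i) //= eqxx big1 // => j /negbTE ->.
  lia.
apply: (@pow_ideal_cancel1 _ i).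
rewrite (_ : x i * (mon b' * s) = mon b' * x i * s); last by ring.
by apply: pow_ideal_le H => j; rewrite bE addnA.
Qed.

End RegularSequences.

(** * Expansion in monomials modulo (x_1^n_1, ..., x_t^n_t) *)

Section MonomialExpansion.
Variables (R : comPzRingType) (t : nat) (x : 'I_t -> R).
Implicit Types (E : set R) (n m b : 'I_t -> nat) (r s z p q : R).

Local Notation I := (pow_ideal x (fun=> 1%N)).
Local Notation mon := (mon x).

(* The bound B makes the set of exponents finite; all those of total degree k
   occur when k <= B. *)
Definition monsum (B k : nat) (c : {ffun 'I_t -> 'I_B.+1} -> R) : R :=
  \sum_(a : {ffun 'I_t -> 'I_B.+1} | (\sum_i a i)%N == k)
    c a * mon (fun i => a i).

(** For an ideal [E] and [k <= B] this is E I^k, with explicit coefficients on the monomials of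
    degree k. *)
Definition hom_span E (B k : nat) : set R :=
  [set p | exists c : {ffun 'I_t -> 'I_B.+1} -> R,
     (forall a, E (c a)) /\ p = monsum k c].

Lemma hom_span_ideal E B k : is_ideal E -> is_ideal (hom_span E B k).
Proof.
move=> idE; split.
- exists (fun=> 0); split=> [_|]; first exact: ideal0.
  by rewrite /monsum big1 // => a _; rewrite mul0r.
- move=> _ _ [c [Ec ->]] [c' [Ec' ->]]; exists (fun a => c a + c' a).
  split=> [a|]; first exact: idealD.
  by rewrite /monsum -big_split; apply: eq_bigr => a _; rewrite mulrDl.
- move=> r _ [c [Ec ->]]; exists (fun a => r * c a).
  split=> [a|]; first exact: ideal_mull.
  by rewrite /monsum mulr_sumr; apply: eq_bigr => a _; rewrite mulrA.
Qed.

Lemma hom_span_mon E B k r b : is_ideal E -> E r -> (\sum_i b i)%N = k ->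
  (k <= B)%N -> hom_span E B k (r * mon b).
Proof.
move=> idE Er bk kB.
have bE i : (inord (b i) : 'I_B.+1) = b i :> nat.
  have : (b i <= k)%N by rewrite -bk (bigD1 i) //= leq_addr.
  by move=> bik; apply: inordK; lia.
pose a0 : {ffun 'I_t -> 'I_B.+1} := [ffun i => inord (b i)].
exists (fun a => if a == a0 then r else 0); split=> [a|].
  by case: ifP => // _; apply: ideal0.
rewrite /monsum (bigD1 a0) /=; last first.
  by rewrite -bk; apply/eqP/eq_bigr => i _; rewrite ffunE bE.
rewrite eqxx big1 ?addr0 => [|a /andP[_ /negbTE ->]]; last by rewrite mul0r.
by congr (_ * _); apply: eq_mon => i; rewrite ffunE bE.
Qed.

Lemma hom_span_mul E B k z b : is_ideal E -> ideal_mul E I z ->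
  (\sum_i b i)%N = k -> (k < B)%N -> hom_span E B k.+1 (z * mon b).
Proof.
move=> idE EIz bk kB; have idH := hom_span_ideal B k.+1 idE.
suff : [set z | hom_span E B k.+1 (z * mon b)] z by [].
apply: (ideal_mul_sub _ _ EIz) => /=.
  split=> /= [|u v|r u]; rewrite ?mul0r ?mulrDl -?mulrA.
  - exact: (ideal0 idH).
  - exact: (idealD idH).
  - exact: (ideal_mull _ idH).
move=> u v Eu Iv.
suff : [set v | hom_span E B k.+1 (u * v * mon b)] v by [].
move: Iv; apply: ideal_gen_sub => [|_ [i _ <-] /=].
  split=> /= [|v1 v2|r v1].
  - by rewrite mulr0 mul0r; apply: (ideal0 idH).
  - by rewrite mulrDr mulrDl; apply: (idealD idH).
  - by rewrite (mulrCA u) -(mulrA r); apply: (ideal_mull _ idH).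
rewrite -mulrA expr1 -(mon1 x i) -monD; apply: hom_span_mon => //.
by rewrite big_split /= bk (bigD1 i) //= eqxx big1 // => j /negbTE ->.
Qed.

(** A monomial with some exponent at least n_i vanishes modulo J. Every other coefficient lies in E
    meet I, hence in E' I, and its factor from I raises the degree by one. *)
Lemma monsum_step E E' n B k (c : {ffun 'I_t -> 'I_B.+1} -> R) :
  is_ideal E' -> (forall a, E (c a)) -> E `&` I `<=` ideal_mul E' I ->
  (k < B)%N ->
  (forall a : {ffun 'I_t -> 'I_B.+1}, (\sum_i a i)%N = k ->
     (forall i, (a i < n i)%N) -> I (c a)) ->
  exists2 q, hom_span E' B k.+1 q & pow_ideal x n (monsum k c - q).
Proof.
move=> idE' Ec EI kB cI; pose small (a : {ffun 'I_t -> 'I_B.+1}) :=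
  [forall i, (a i < n i)%N].
rewrite /monsum (bigID small) /=.
set q := (X in X + _); exists q; last first.
  rewrite addrC addrK; apply: (ideal_sum _ (pow_ideal_is_ideal x n)) => a.
  move=> /andP[_]; rewrite negb_forall => /existsP[i]; rewrite -leqNgt => na.
  apply: (ideal_mull _ (pow_ideal_is_ideal x n)).
  by apply: (@pow_ideal_mon _ _ _ _ _ i).
apply: (ideal_sum _ (hom_span_ideal _ _ idE')) => a /andP[/eqP ak /forallP sa].
by apply: hom_span_mul => //; apply: EI; split=> //; apply: cI.
Qed.

Hypothesis x_reg : permutable_regular_sequence x.

(** Multiplying by the complementary monomial isolates the coefficient of [a]: another exponent of
    the same degree exceeds [a] at some index i, where the product reaches the power n_i. *)
Lemma monsum_mod_box n B k (c : {ffun 'I_t -> 'I_B.+1} -> R)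
    (a : {ffun 'I_t -> 'I_B.+1}) b :
  (forall i, a i + b i = (n i).-1)%N -> (forall i, (0 < n i)%N) ->
  (\sum_i a i)%N = k ->
  pow_ideal x n (monsum k c * mon b - c a * mon (fun i => (n i).-1)).
Proof.
move=> abn n0 ak; have idJ := pow_ideal_is_ideal x n.
rewrite /monsum (bigD1 a) /=; last by apply/eqP.
rewrite mulrDl -mulrA -monD (eq_mon _ abn) addrC addrA addNr add0r.
rewrite mulr_suml; apply: (ideal_sum _ idJ) => a' /andP[/eqP a'k a'a].
rewrite -mulrA -monD; apply: (ideal_mull _ idJ).
have [i ai] : exists i, (a i < a' i)%N.
  apply/existsP; apply: contraR a'a; rewrite negb_exists => /forallP le.
  have {}le i : (a' i <= a i)%N by rewrite leqNgt le.
  apply/eqP/ffunP => i; apply/val_inj/eqP => /=; rewrite eqn_leq le /=.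
  rewrite leqNgt; apply/negP => lt.
  have : (\sum_i a' i < \sum_i a i)%N.
    rewrite (bigD1 i) //= [X in (_ < X)%N](bigD1 i) //= -addSn.
    by apply: leq_add => //; apply: leq_sum.
  by rewrite a'k ak ltnn.
by apply: (@pow_ideal_mon _ _ _ _ _ i); have := abn i; have := n0 i; lia.
Qed.

Lemma mon_cancel_box n s : (forall i, (0 < n i)%N) ->
  pow_ideal x n (s * mon (fun i => (n i).-1)) -> I s.
Proof.
move=> n0 Js; apply: (pow_ideal_cancel x_reg (b := fun i => (n i).-1)).
by rewrite mulrC; apply: pow_ideal_le Js => i; have := n0 i; lia.
Qed.

(** By contradiction: if only s in I occur, the relevant coefficients in any expansion of r lie in
    I, so r can be rewritten modulo J in ever higher degree, until all monomials are in J. *)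
Lemma socle_reduction n r : (0 < t)%N -> (forall i, (0 < n i)%N) ->
  ~ pow_ideal x n r ->
  exists b s, ~ I s /\
    pow_ideal x n (r * mon b - s * mon (fun i => (n i).-1)).
Proof.
move=> t0 n0 nJr; apply: contrapT => nbs; apply: nJr.
have idJ := pow_ideal_is_ideal x n.
have {}nbs b s :
    pow_ideal x n (r * mon b - s * mon (fun i => (n i).-1)) -> I s.
  by move=> Jbs; apply: contrapT => nIs; apply: nbs; exists b, s.
pose B := (\sum_i n i)%N.
have expand k : (k <= B)%N ->
    exists2 q, hom_span setT B k q & pow_ideal x n (r - q).
  elim: k => [|k IHk] kB.
    exists r; last by rewrite subrr; apply: ideal0.
    have -> : r = r * mon (fun=> 0%N).
      by rewrite /mon big1 ?mulr1 // => i _; rewrite expr0.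
    by apply: hom_span_mon; rewrite ?big1.
  have [|_ [c [_ ->]] Jrq] := IHk; first exact: ltnW.
  have [//|//| |//| |q Hq Jq] := @monsum_step setT setT n B k c.
  - by move=> z [_ Iz]; rewrite -(mul1r z); apply: ideal_mul_mem.
  - move=> a ak an; pose b i := ((n i).-1 - a i)%N.
    apply: (nbs b); have abn i : (a i + b i = (n i).-1)%N.
      by have := an i; rewrite /b; lia.
    have := monsum_mod_box c abn n0 ak.
    move=> Jc; rewrite -(subrK (monsum k c * mon b) (r * mon b)) -addrA -mulrBl.
    by apply: (idealD idJ) => //; apply: (ideal_mulr _ idJ).
  - exists q => //; rewrite -(subrK (monsum k c) r) -addrA.
    exact: (idealD idJ).
have [//|_ [c [_ ->]] Jrq] := expand B.
rewrite -(subrK (monsum B c) r); apply: (idealD idJ) => //.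
apply: (ideal_sum _ idJ) => a /eqP aB; apply: (ideal_mull _ idJ).
(* Otherwise the degree B = n_1 + ... + n_t of [a] would be at most B - t, while t > 0. *)
have [i ia] : exists i, (n i <= a i)%N.
  apply/existsP; apply: contraT; rewrite negb_exists => /forallP lt.
  have : (\sum_i (a i).+1 <= \sum_i n i)%N.
    by apply: leq_sum => i _; have := lt i; lia.
  rewrite (eq_bigr (fun i => a i + 1)%N) => [|i _]; last by rewrite addn1.
  by rewrite big_split /= aB sum1_card card_ord -/B; lia.
by apply: (@pow_ideal_mon _ _ _ _ _ i).
Qed.

(** Each use of [monsum_step] raises the degree by one and moves one place along [E]; once the
    degree of the top monomial is reached, its coefficient agrees with s modulo I. *)
Lemma filtration_descent n (E : nat -> set R) p s :
  (forall i, (0 < n i)%N) -> (forall k, is_ideal (E k)) ->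
  (forall k, E k `&` I `<=` ideal_mul (E k.+1) I) -> E 0%N p ->
  pow_ideal x n (p - s * mon (fun i => (n i).-1)) ->
  exists2 s', E (\sum_i (n i).-1)%N s' & I (s - s').
Proof.
move=> n0 idE EI Ep Jps; have idJ := pow_ideal_is_ideal x n.
pose d := (\sum_i (n i).-1)%N; set top := mon _ in Jps.
have expand k : (k <= d)%N -> exists2 q, hom_span (E k) d k q &
    pow_ideal x n (q - s * top).
  elim: k => [|k IHk] kd.
    exists p => //; have -> : p = p * mon (fun=> 0%N).
      by rewrite /mon big1 ?mulr1 // => i _; rewrite expr0.
    by apply: hom_span_mon; rewrite ?big1.
  have [|_ [c [Ec ->]] Jc] := IHk; first exact: ltnW.
  have [//|//|//|//| |q Hq Jq] := @monsum_step (E k) (E k.+1) n d k c.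
    (* As a_i + 1 <= n_i, J lies in [pow_ideal x m], modulo which the degree k part reduces to c_a
       x^a. Since k < d, some n_i - 1 exceeds a_i, so the top monomial vanishes there too;
       cancelling x^a gives c_a in I. *)
    move=> a ak an; pose m i := (a i).+1.
    have idm := pow_ideal_is_ideal x m.
    apply: (@mon_cancel_box m) => //=.
    have abm i : (a i + 0 = (m i).-1)%N by rewrite addn0.
    have /(idealN idm) := monsum_mod_box c abm (fun=> erefl) ak.
    rewrite opprB => /(idealDr idm); apply.
    apply: (idealN idm); apply: (ideal_mulr _ idm).
    rewrite -(subrK (s * top) (monsum k c)).
    apply: (idealD idm); first exact: pow_ideal_le Jc.
    apply: (ideal_mull _ idm).
    have [i ai] : exists i, (m i <= (n i).-1)%N.
      apply/existsP; apply: contraT; rewrite negb_exists => /forallP lt.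
      have : (d <= k)%N; last by lia.
      by rewrite -ak; apply: leq_sum => i _; have := lt i; rewrite /m; lia.
    by apply: (@pow_ideal_mon _ _ _ _ _ i).
  exists q => //.
  rewrite (_ : _ - _ = (monsum k c - s * top) - (monsum k c - q)); last by ring.
  exact: (idealB idJ).
have [//|_ [c [Ec ->]] Jc] := expand d.
have nd i : ((n i).-1 < d.+1)%N.
  by rewrite ltnS /d (bigD1 i) //= leq_addr.
pose a : {ffun 'I_t -> 'I_d.+1} := [ffun i => Ordinal (nd i)].
exists (c a) => //; apply: (@mon_cancel_box n) => //.
have an i : (a i + 0 = (n i).-1)%N by rewrite ffunE addn0.
have ad : (\sum_i a i = d)%N by apply: eq_bigr => i _; rewrite ffunE.
have := monsum_mod_box c an n0 ad.
rewrite [mon (fun=> 0%N)]big1 ?mulr1 => [Ja|i _]; last by rewrite expr0.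
rewrite mulrBl -/top.
rewrite (_ : _ - _ = (monsum d c - c a * top) - (monsum d c - s * top)).
  exact: (idealB idJ).
by ring.
Qed.

End MonomialExpansion.

(** * Primary components *)

Section PrimaryComponents.
Variable R : comPzRingType.
Implicit Types (J P Q : set R) (a b r w z : R).

Lemma radical_ideal J : is_ideal J -> is_ideal (radical J).
Proof.
move=> idJ; split.
- by exists 1%N; rewrite expr1; apply: ideal0.
- move=> a b [i Ja] [j Jb]; exists (i + j)%N; rewrite exprDn.
  apply: ideal_sum => // k _; rewrite -mulr_natl; apply: ideal_mull => //.
  have [jk|kj] := leqP j k.
    by apply: ideal_mull => //; rewrite -(subnK jk) exprD; apply: ideal_mull.
  apply: ideal_mulr => //; have -> : (i + j - k = (j - k) + i)%N by lia.
  by rewrite exprD; apply: ideal_mull.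
- by move=> r a [i Ja]; exists i; rewrite exprMn; apply: ideal_mull.
Qed.

Lemma radical_prime Q : primary_ideal Q -> prime_ideal (radical Q).
Proof.
move=> [idQ Q1 prQ]; split; first exact: radical_ideal.
  by move=> [k]; rewrite expr1n.
move=> a b [k]; rewrite exprMn => /prQ[Qa|[m Qb]]; [left|right].
  by exists k.
by exists (k * m)%N; rewrite exprM.
Qed.

(** Induction on generators of the radical: if P^c and y^k lie in J, so does each term P^(c+k-i) y^i
    of (P + (y))^(c+k), because i >= k or c + k - i >= c. *)
Lemma ideal_pow_radical_sub J : noetherian R -> is_ideal J ->
  exists c, ideal_pow (radical J) c `<=` J.
Proof.
move=> R_noeth idJ.
have [s sE] := noetherian_seq R_noeth (radical_ideal idJ).
have sJ : [set` s] `<=` radical J by rewrite sE; apply: sub_ideal_gen.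
rewrite sE {sE}; elim: s sJ => [|y s IHs] sJ.
  exists 1%N; rewrite ideal_gen_nil; apply: ideal_mul_sub => // a b -> _.
  by rewrite mul0r; apply: ideal0.
have [|c cJ] := IHs; first by move=> z zs; apply: sJ; rewrite /= inE zs orbT.
have [|k Jy] := sJ y; first by rewrite /= mem_head.
exists (c + k)%N => z; rewrite ideal_gen_cons adjoin_powE; last first.
  exact: ideal_gen_ideal.
move=> [d [Pd ->]]; apply: ideal_sum => // i _.
have [ki|ik] := leqP k i.
  by rewrite -(subnK ki) exprD mulrA; apply: ideal_mull.
apply: ideal_mulr => //; apply: cJ; apply: ideal_pow_le (Pd i _) => //; lia.
Qed.

(* The contraction to R of the extension of P^e + J to the localization at P. *)
Definition primary_part P J (e : nat) : set R :=
  [set r | exists2 w, ~ P w & exists2 p, ideal_pow P e p & J (w * r - p)].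

Section PrimaryPart.
Variables (P J : set R) (e : nat).
Hypotheses (prP : prime_ideal P) (idJ : is_ideal J).

Lemma primary_part_ideal : is_ideal (primary_part P J e).
Proof.
case: prP => idP P1 PM; have idPe := ideal_pow_ideal P e; split.
- exists 1 => //; exists 0; first exact: ideal0.
  by rewrite mulr0 subr0; apply: ideal0.
- move=> a b [v nPv [p Pp Jp]] [w nPw [q Pq Jq]].
  exists (v * w); first by move=> /PM[].
  exists (w * p + v * q).
    by apply: idealD => //; apply: ideal_mull.
  rewrite (_ : _ - _ = w * (v * a - p) + v * (w * b - q)); last by ring.
  by apply: idealD => //; apply: ideal_mull.
- move=> r a [v nPv [p Pp Jp]]; exists v => //.
  exists (r * p); first exact: ideal_mull.
  rewrite (_ : _ - _ = r * (v * a - p)); last by ring.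
  exact: ideal_mull.
Qed.

Lemma sub_primary_part : J `<=` primary_part P J e.
Proof.
move=> z Jz; exists 1; first by case: prP.
exists 0; first by apply: ideal0; apply: ideal_pow_ideal.
by rewrite mul1r subr0.
Qed.

Lemma ideal_pow_sub_primary_part : ideal_pow P e `<=` primary_part P J e.
Proof.
move=> z Pz; exists 1; first by case: prP.
by exists z; rewrite // mul1r subrr; apply: ideal0.
Qed.

Hypotheses (JP : J `<=` P) (e_gt0 : (0 < e)%N).

Lemma primary_part_sub : primary_part P J e `<=` P.
Proof.
case: prP => idP _ PM z [w nPw [p Pp /JP Pwz]].
have Pp' := ideal_pow_sub idP e_gt0 Pp.
have : P (w * z) by rewrite -(subrK p (w * z)); apply: idealD.
by move=> /PM[].
Qed.

Lemma radical_primary_part : radical (primary_part P J e) = P.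
Proof.
case: (prP) => idP P1 PM; apply/seteqP; split=> z.
  move=> [k /primary_part_sub]; elim: k => [|k IHk]; first by rewrite expr0.
  by rewrite exprS => /PM[].
by move=> Pz; exists e; apply: ideal_pow_sub_primary_part; apply: ideal_powX.
Qed.

(** An element b outside P can be absorbed into the denominator [w]. *)
Lemma primary_part_primary : primary_ideal (primary_part P J e).
Proof.
case: (prP) => idP P1 PM; split; first exact: primary_part_ideal.
  by move=> /primary_part_sub.
move=> a b [w nPw [p Pp Jp]]; rewrite radical_primary_part.
have [Pb|nPb] := pselect (P b); [by right|left].
exists (w * b); first by move=> /PM[].
by exists p; rewrite // -mulrA (mulrC b).
Qed.

End PrimaryPart.
End PrimaryComponents.

(** * Descent from J to I, and the resulting decomposition *)

(** Apply [filtration_descent] to the ideals P^(e - k h), each step losing the Artin-Rees constant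
    [h]. After at most N = n_1 + ... + n_t steps the exponent is at least (c + h) N - h N = c N >=
    c. *)
Lemma primary_part_descent (R : comPzRingType) (t : nat) (x : 'I_t -> R)
    (n : 'I_t -> nat) (P : set R) (h c e : nat) (s : R) :
  permutable_regular_sequence x -> (forall i, 0 < n i)%N ->
  (forall k, ideal_pow P k `&` pow_ideal x (fun=> 1%N) `<=`
     ideal_mul (ideal_pow P (k - h)) (pow_ideal x (fun=> 1%N))) ->
  (0 < t)%N -> ((c + h) * \sum_i n i <= e)%N ->
  primary_part P (pow_ideal x n) e
    (s * mon x (fun i => (n i).-1)) ->
  primary_part P (pow_ideal x (fun=> 1%N)) c s.
Proof.
move=> x_reg n0 AR t0 Ne [w nPw [p Pp Jp]]; exists w => //.
have idJ := pow_ideal_is_ideal x n.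
set N := (\sum_i n i)%N in Ne; pose f k := (e - k * h)%N.
have N0 : (0 < N)%N by rewrite /N (bigD1 (Ordinal t0)) //= addn_gt0 n0.
have dN : (\sum_i (n i).-1 <= N)%N by apply: leq_sum => i _; apply: leq_pred.
have [||||s' Ps' Is'] := @filtration_descent _ _ x x_reg n
    (fun k => ideal_pow P (f k)) p (w * s) n0.
- by move=> k; apply: ideal_pow_ideal.
- move=> k z /AR; have -> // : f k.+1 = (f k - h)%N.
  by rewrite /f mulSn (addnC h) subnDA.
- by rewrite /f mul0n subn0.
- by rewrite -opprB; apply: (idealN idJ); rewrite -mulrA.
exists s' => //; apply: ideal_pow_le Ps'; rewrite /f.
have : ((\sum_i (n i).-1) * h <= N * h)%N by rewrite leq_mul2r dN orbT.
have : (c <= c * N)%N by rewrite leq_pmulr.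
by move: Ne; rewrite mulnDl (mulnC h); lia.
Qed.

Theorem theorem1p1 (R : comPzRingType) (t : nat) (x : 'I_t -> R)
    (R_noeth : noetherian R) (t_gt0 : (0 < t)%N)
    (x_reg : permutable_regular_sequence x) :
  exists (Lambda : set (set R)) (C : nat),
    [/\ finite_set Lambda,
        forall P, Lambda P -> prime_ideal P
      & forall n : 'I_t -> nat,
          exists (l : nat) (Q : 'I_l -> set R),
            primary_decomposition (ideal_gen (range (fun i => x i ^+ n i))) Q
            /\ forall i : 'I_l,
                 Lambda (radical (Q i)) /\
                 ideal_pow (radical (Q i)) (C * \sum_(j < t) n j)%N `<=` Q i].
Proof.
pose I := pow_ideal x (fun=> 1%N).
have idI : is_ideal I := pow_ideal_is_ideal _ _.
have [l [q [prq Iq]]] := lasker_noether R_noeth idI.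
have prP i : prime_ideal (radical (q i)) by apply: radical_prime.
have idq i : is_ideal (q i) by case: (prq i).
have /boolp.choice[c cP] i := ideal_pow_radical_sub R_noeth (idq i).
have /boolp.choice[h hP] i :
    exists h, forall e, ideal_pow (radical (q i)) e `&` I `<=`
      ideal_mul (ideal_pow (radical (q i)) (e - h)) I.
  by apply: artin_rees => //; case: (prP i).
(* The sum dominates every c_i + h_i and depends on I alone; its successor will serve as the
   constant, to make the exponents positive. *)
pose C := (\sum_i (c i + h i))%N.
have Iqi i : I `<=` q i by rewrite Iq => z; apply.
have qP i : q i `<=` radical (q i) by move=> z qz; exists 1%N; rewrite expr1.
exists (range (fun i => radical (q i))), C.+1; split.
- exact: finite_image.
- by move=> _ [i _ <-].
move=> n; pose J := pow_ideal x n; rewrite -/J.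
have idJ : is_ideal J by apply: pow_ideal_is_ideal.
(* If some n_i is 0, then J is the unit ideal, the empty intersection. *)
have [/existsP[i /eqP ni]|] := boolP [exists i, n i == 0%N].
  exists 0%N, (fun=> setT); split; last by case.
  split; first by case.
  apply/seteqP; split=> z // _; rewrite -(mulr1 z); apply: (ideal_mull _ idJ).
  by apply: sub_ideal_gen; exists i => //; rewrite ni expr0.
rewrite negb_exists => /forallP n_neq0.
have n_gt0 i : (0 < n i)%N by rewrite lt0n n_neq0.
pose N := (\sum_i n i)%N.
have N_gt0 : (0 < N)%N by rewrite /N (bigD1 (Ordinal t_gt0)) //= addn_gt0 n_gt0.
have JI : J `<=` I by apply: pow_ideal_le.
have JP i : J `<=` radical (q i) by move=> z /JI /Iqi /qP.
have CN_gt0 : (0 < C.+1 * N)%N by rewrite muln_gt0.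
exists l, (fun i => primary_part (radical (q i)) J (C.+1 * N)).
split; last first.
  move=> i; rewrite radical_primary_part //; split; first by exists i.
  exact: ideal_pow_sub_primary_part.
split; first by move=> i; apply: primary_part_primary.
apply/seteqP; split=> r; first by move=> Jr i _; apply: sub_primary_part.
move=> Qr; apply: contrapT => nJr.
have [b [s [nIs Jbs]]] := socle_reduction t_gt0 n_gt0 nJr.
apply: nIs; rewrite -/I Iq => i _.
have idQ : is_ideal (primary_part (radical (q i)) J (C.+1 * N)).
  exact: primary_part_ideal.
have Qs : primary_part (radical (q i)) J (C.+1 * N)
    (s * mon x (fun i => (n i).-1)).
  rewrite -(subrK (r * mon x b) (s * _)); apply: (idealD idQ).
    by apply: sub_primary_part => //; rewrite -opprB; apply: (idealN idJ).
  by apply: (ideal_mulr _ idQ); apply: Qr.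
have [|w nPw [p Pp Iwp]] :=
    primary_part_descent (c := c i) x_reg n_gt0 (hP i) t_gt0 _ Qs.
  rewrite leq_mul2r; apply/orP; right; rewrite /C (bigD1 i) //=; lia.
(* Here w s lies in P^c + I, which is inside q_i; as w is outside P, primariness puts s in q_i. *)
have qw : q i (s * w).
  rewrite mulrC -(subrK p (w * s)); apply: idealD => //; first exact: Iqi.
  exact: cP.
by case: (prq i) => _ _ prqi; case: (prqi _ _ qw).
Qed.
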